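(* Let $(R,\mathfrak m)$ be a regular local ring of dimension $n$, $f\in R$ a non-unit with $m=\operatorname{ord}_{\mathfrak m}(f)>1$, $R'=R/\langle f\rangle$ with maximal ideal $\mathfrak m'$, and suppose $R'$ is in the extremal case. Let $u_1,\dots,u_{n-1},y_1\in R$ be a regular system of parameters of $R$ with $\operatorname{In}_{\mathfrak m}(f)=\operatorname{In}_{\mathfrak m}(y_1)^m$. Then $\bar\nu_{\mathfrak m'}(y'_1)=\delta(\Delta(f,u,y_1))$, where $y'_1$ is the class of $y_1$ in $R'$.
   Context: $\bar\nu_{\mathfrak m'}(a)=\lim_k\nu_{\mathfrak m'}(a^k)/k$, $\nu_{\mathfrak m'}(b)=\sup\{s:b\in\mathfrak m'^s\}$. With $\lambda_{\mathfrak m'}:\mathfrak m'/\mathfrak m'^2\to\{\bar\nu_{\mathfrak m'}\ge1\}/\{\bar\nu_{\mathfrak m'}>1\}$ the natural map and $t=\dim(\mathfrak m'/\mathfrak m'^2)-\dim R'>0$, $R'$ is in the extremal case if $\dim\ker\lambda_{\mathfrak m'}=t$. CP-expansion w.r.t. $(u,y_1)$: unique finite $S(f)\subset\mathbb N^{n-1}\times\mathbb N$ with $\{u^\alpha y_1^i\}_{(\alpha,i)\in S(f)}$ minimally generating the ideal it generates and units $c_{\alpha,i}$ with $f=\sum c_{\alpha,i}u^\alpha y_1^i$. Hironaka's polyhedron: $\Delta(f,u,y_1)=\operatorname{Conv}(\{\alpha/(m-i):(\alpha,i)\in S(f),i<m\}+\mathbb N^{n-1})\subset\mathbb R^{n-1}$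 and $\delta(P)=\min\{|\gamma|:\gamma\in P\}$ (with value $\infty$ for the empty set), $|\gamma|$ the sum of coordinates. *)

(* Defs.v *)
From HB Require Import structures.
From mathcomp Require Import all_boot all_order all_algebra.
From mathcomp Require Import all_classical all_reals all_analysis.
Set Implicit Arguments. Unset Strict Implicit. Unset Printing Implicit Defensive.
Import Order.TTheory GRing.Theory Num.Theory.
Local Open Scope ring_scope.

Section RingDefs.
Variable A : comUnitRingType.
Implicit Types (I J M N : A -> Prop).

Definition ideal I :=
  I 0 /\ (forall x y, I x -> I y -> I (x + y)) /\ (forall a x, I x -> I (a * x)).

Definition gen_ideal (s : seq A) (x : A) :=
  exists c : 'I_(size s) -> A, x = \sum_(i < size s) c i * s`_i.

Definition noetherian :=
  forall I, ideal I -> exists s : seq A, forall x, I x <-> gen_ideal s x.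

Definition prime_ideal (P : A -> Prop) :=
  ideal P /\ ~ P 1 /\ (forall a b, P (a * b) -> P a \/ P b).

Definition prime_chain (d : nat) (P : nat -> A -> Prop) :=
  (forall i, (i <= d)%N -> prime_ideal (P i)) /\
  (forall i, (i < d)%N ->
     (forall x, P i x -> P i.+1 x) /\ exists x, P i.+1 x /\ ~ P i x).

Definition krull_dim (d : nat) :=
  (exists P, prime_chain d P) /\ ~ (exists P, prime_chain d.+1 P).

Definition local_ring M :=
  ideal M /\ (forall x, M x <-> ~~ (x \is a GRing.unit)).

Definition prod_ideal I J (x : A) :=
  exists k (a b : 'I_k -> A), (forall i, I (a i) /\ J (b i)) /\
                              x = \sum_(i < k) a i * b i.

Fixpoint ipow M (s : nat) : A -> Prop :=
  match s with
  | 0 => fun _ => True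
  | s'.+1 => prod_ideal M (ipow M s')
  end.

Definition regular_local M (n : nat) :=
  noetherian /\ local_ring M /\ krull_dim n /\
  exists s : seq A, size s = n /\ forall x, M x <-> gen_ideal s x.

(* dim_k (N / M^2) = t, for M^2 <= N <= M, k = A/M : existence of a basis *)
Definition mod_dim M N (t : nat) :=
  exists x : 'I_t -> A,
    (forall i, N (x i)) /\
    (forall y, N y -> exists a : 'I_t -> A, ipow M 2 (y - \sum_(i < t) a i * x i)) /\
    (forall a : 'I_t -> A, ipow M 2 (\sum_(i < t) a i * x i) -> forall i, M (a i)).

Definition same_initial_form M (d : nat) (a b : A) :=
  ipow M d a /\ ~ ipow M d.+1 a /\ ipow M d b /\ ~ ipow M d.+1 b /\
  ipow M d.+1 (a - b).

Variable K : realType.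
Local Open Scope ereal_scope.

Definition nu M (b : A) : \bar K :=
  ereal_sup [set (s%:R)%:E | s in [set s : nat | ipow M s b]].

Definition nubar M (a : A) : \bar K :=
  limn (fun k : nat => nu M (a ^+ k.+1) * ((k.+1)%:R^-1)%:E).

(* kernel of lambda_M : M/M^2 -> {nubar >= 1}/{nubar > 1}, as a subset of M *)
Definition ker_lambda M (x : A) := M x /\ 1 < nubar M x.

Definition extremal M :=
  exists e d : nat, mod_dim M M e /\ krull_dim d /\ (d < e)%N /\
                    mod_dim M (ker_lambda M) (e - d).

End RingDefs.

Section CP.
Variables (A : comUnitRingType) (n1 : nat).


Definition mon (u : 'I_n1 -> A) (y1 : A) (p : n1.-tuple nat * nat) : A :=
  (\prod_(j < n1) u j ^+ tnth p.1 j) * y1 ^+ p.2.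

Definition CP_expansion (u : 'I_n1 -> A) (y1 : A) (f : A) (S : seq (n1.-tuple nat * nat))
    (c : n1.-tuple nat * nat -> A) :=
  uniq S /\ (forall p, p \in S -> c p \is a GRing.unit) /\
  f = \sum_(p <- S) c p * mon u y1 p /\
  (forall p, p \in S ->
     ~ gen_ideal [seq mon u y1 q | q <- S & q != p] (mon u y1 p)).

Variable K : realType.

(* Hironaka's polyhedron Conv({alpha/(m-i) : (alpha,i) in S, i < m} + N^{n-1}) *)
Definition hironaka (m : nat) (S : seq (n1.-tuple nat * nat)) : set ('I_n1 -> K) :=
  [set g | exists k (lam : 'I_k -> K) (p : 'I_k -> n1.-tuple nat * nat)
             (w : 'I_k -> n1.-tuple nat),
      (forall i, 0 <= lam i) /\ \sum_(i < k) lam i = 1 /\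
      (forall i, p i \in S /\ ((p i).2 < m)%N) /\
      forall j, g j = \sum_(i < k) lam i *
                 ((tnth (p i).1 j)%:R / (m - (p i).2)%:R + (tnth (w i) j)%:R)].

(* delta(P) = min { |g| : g in P }, +oo for P empty *)
Definition delta (P : set ('I_n1 -> K)) : \bar K :=
  ereal_inf [set (\sum_(j < n1) g j)%:E | g in P].

End CP.

(* Main.v *)
Require Import Defs.
From HB Require Import structures.
From mathcomp Require Import all_boot all_order all_algebra.
From mathcomp Require Import all_classical all_reals all_analysis.
From mathcomp Require Import zify ring.
Set Implicit Arguments. Unset Strict Implicit. Unset Printing Implicit Defensive.
Import Order.TTheory GRing.Theory Num.Theory numFieldNormedType.Exports.
Local Open Scope ring_scope.

(** If y_1^m is the only monomial of f, then y_1' is nilpotent and both sides are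
    infinite.  Otherwise write delta = a/b and give u_j the weight b and y_1 the
    weight a, so that f has weight a m and y_1^m is not its only monomial of that
    weight.  In R', the equation f = 0 rewrites y_1^m by monomials u^alpha y_1^i with i < m and weight
    at least a m, hence y_1^k lies in the power of m' of exponent (a/b)(k - m).
    Conversely, y_1^k in m'^s means that y_1^k - h f has weight at least b s; if
    b s > a k, then the initial form of h f would be y_1^k, although the initial form
    of f is not a monomial.  Initial forms make sense because the parameters of a
    regular local ring are analytically independent for any positive weights w: a
    relation expressing a monomial by monomials of larger weight would force a
    prime containing the n - 1 elements u_j^{w(y_1)} - y_1^{w(u_j)} to be maximal,
    against Krull's height theorem.  That theorem is obtained from the principal
    ideal theorem by moving the elements one by one into the bottom of a chain of
    primes. *)

(** * Krull's principal ideal theorem *)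

Section Ideals.
Variable A : comUnitRingType.
Implicit Types (I J K P Q : A -> Prop).

Lemma ideal_sum I T (r : seq T) (B : pred T) (F : T -> A) :
  ideal I -> (forall i, B i -> I (F i)) -> I (\sum_(i <- r | B i) F i).
Proof. by move=> [I0 [ID _]] IF; apply: (big_ind I). Qed.

Lemma ideal_opp I x : ideal I -> I x -> I (- x).
Proof. by move=> [_ [_ IM]] Ix; rewrite -mulN1r; apply: IM. Qed.

Lemma ideal_sub I x y : ideal I -> I x -> I y -> I (x - y).
Proof. by move=> hI Ix Iy; apply: hI.2.1 => //; apply: ideal_opp. Qed.

Lemma ideal_mulr I a x : ideal I -> I x -> I (x * a).
Proof. by move=> hI Ix; rewrite mulrC; apply: hI.2.2. Qed.

Definition ideal_add I J (x : A) := exists a b, I a /\ J b /\ x = a + b.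

Definition principal (a x : A) := exists r, x = r * a.

Lemma ideal_principal a : ideal (principal a).
Proof.
split; first by exists 0; rewrite mul0r.
split; first by move=> _ _ [r ->] [r' ->]; exists (r + r'); rewrite mulrDl.
by move=> b _ [r ->]; exists (b * r); rewrite mulrA.
Qed.

Lemma principal_id a : principal a a.
Proof. by exists 1; rewrite mul1r. Qed.

Lemma ideal_addP I J : ideal I -> ideal J -> ideal (ideal_add I J).
Proof.
move=> hI hJ; split; first by exists 0, 0; split; [exact: hI.1|split; [exact: hJ.1|rewrite addr0]].
split.
  move=> _ _ [a [b [Ia [Jb ->]]]] [a' [b' [Ia' [Jb' ->]]]].
  exists (a + a'), (b + b'); split; first exact: hI.2.1.
  by split; [exact: hJ.2.1|rewrite addrACA].
move=> r _ [a [b [Ia [Jb ->]]]]; exists (r * a), (r * b).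
by split; [exact: hI.2.2|split; [exact: hJ.2.2|rewrite mulrDr]].
Qed.

Lemma ideal_addl I J x : ideal J -> I x -> ideal_add I J x.
Proof. by move=> hJ Ix; exists x, 0; split=> //; split; [exact: hJ.1|rewrite addr0]. Qed.

Lemma ideal_addr I J x : ideal I -> J x -> ideal_add I J x.
Proof. by move=> hI Jx; exists 0, x; split; [exact: hI.1|split=> //; rewrite add0r]. Qed.

Lemma ideal_gen (s : seq A) : ideal (gen_ideal s).
Proof.
split; first by exists (fun=> 0); rewrite big1 // => i _; rewrite mul0r.
split.
  move=> _ _ [c ->] [c' ->]; exists (fun i => c i + c' i).
  by rewrite -big_split; apply: eq_bigr => i _; rewrite mulrDl.
by move=> r _ [c ->]; exists (fun i => r * c i); rewrite big_distrr; apply: eq_bigr => i _; rewrite /= mulrA.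
Qed.

Lemma mem_gen_ideal (s : seq A) a : a \in s -> gen_ideal s a.
Proof.
move=> /(nthP 0) [i lis <-]; exists (fun j => (j == Ordinal lis)%:R).
rewrite (bigD1 (Ordinal lis)) //= eqxx mul1r big1 ?addr0 // => j /negPf ->.
by rewrite mul0r.
Qed.

Lemma gen_ideal_sub (s : seq A) I : ideal I -> (forall a, a \in s -> I a) ->
  forall x, gen_ideal s x -> I x.
Proof.
move=> hI sI _ [c ->]; apply: ideal_sum => // i _; apply: hI.2.2.
by apply: sI; apply: mem_nth.
Qed.

(** If no member were maximal, choice would give a strictly ascending chain; its union is finitely
    generated, and all generators already lie in one member. *)
Lemma noetherian_maximal (F : (A -> Prop) -> Prop) I0 : noetherian A ->
  (forall I, F I -> ideal I) -> F I0 ->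
  exists2 I, F I & forall J, F J -> (forall x, I x -> J x) -> forall x, J x -> I x.
Proof.
move=> nA Fid FI0; apply: contrapT => nmax.
have next (I : {I | F I}) : exists J : {J | F J},
    (forall x, sval I x -> sval J x) /\ exists2 x, sval J x & ~ sval I x.
  case: I => I FI /=; apply: contrapT => nJ; apply: nmax; exists I => // J FJ IJ x Jx.
  by apply: contrapT => nIx; apply: nJ; exists (exist _ J FJ); split=> //; exists x.
have [nx nxP] := choice next.
pose c k := sval (iter k nx (exist _ I0 FI0)).
have cS k x : c k x -> c k.+1 x by exact: (nxP _).1.
have cle i j : (i <= j)%N -> forall x, c i x -> c j x.
  move=> /subnK <-; elim: (j - i)%N => // d IH x /IH; exact: cS.
have cid k : ideal (c k) by apply: Fid; rewrite /c; case: (iter k _ _).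
have Uid : ideal (fun x => exists k, c k x).
  split; first by exists 0%N; exact: (cid 0%N).1.
  split.
    move=> x y [i ci] [j cj]; exists (maxn i j); apply: (cid _).2.1.
      by apply: cle ci; exact: leq_maxl.
    by apply: cle cj; exact: leq_maxr.
  by move=> a x [i ci]; exists i; apply: (cid _).2.2.
have [s sP] := nA _ Uid.
have [k kP] : exists k, forall a, a \in s -> c k a.
  have : forall a, a \in s -> exists k, c k a.
    by move=> a /mem_gen_ideal /sP.
  elim: s {sP} => [|a s IH] h; first by exists 0%N.
  have [|k kP] := IH; first by move=> b bs; apply: h; rewrite inE bs orbT.
  have [|j jP] := h a; first by rewrite inE eqxx.
  exists (maxn j k) => b; rewrite inE => /orP [/eqP ->|/kP].
    by apply: cle jP; exact: leq_maxl.
  by apply: cle; exact: leq_maxr.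
have [x cx ncx] := (nxP (iter k nx (exist _ I0 FI0))).2.
apply: ncx; apply: (gen_ideal_sub (cid k) kP); apply/sP; by exists k.+1.
Qed.

(* Working with P-saturated ideals replaces localizing at the prime P. *)
Definition saturation P I (a : A) := exists2 s, ~ P s & I (s * a).
Definition saturated P I := forall s a, ~ P s -> I (s * a) -> I a.

Lemma prime_mul_notin P s t : prime_ideal P -> ~ P s -> ~ P t -> ~ P (s * t).
Proof. by move=> [_ [_ h]] ns nt /h []. Qed.

Lemma ideal_saturation P I : prime_ideal P -> ideal I -> ideal (saturation P I).
Proof.
move=> pP hI; split; first by exists 1; [exact: pP.2.1|rewrite mulr0; exact: hI.1].
split.
  move=> x y [s ns Ix] [t nt Iy]; exists (s * t); first exact: prime_mul_notin.
  rewrite mulrDr; apply: hI.2.1; first by rewrite mulrAC; apply: ideal_mulr.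
  by rewrite -mulrA; apply: hI.2.2.
by move=> a x [s ns Ix]; exists s => //; rewrite mulrCA; apply: hI.2.2.
Qed.

Lemma saturated_saturation P I : prime_ideal P -> saturated P (saturation P I).
Proof.
move=> pP s a ns [t nt h]; exists (t * s); first exact: prime_mul_notin.
by rewrite -mulrA.
Qed.

Lemma sub_saturation P I x : prime_ideal P -> I x -> saturation P I x.
Proof. by move=> pP Ix; exists 1; [exact: pP.2.1|rewrite mul1r]. Qed.

Lemma saturatedW P Q I : (forall x, Q x -> P x) -> saturated Q I -> saturated P I.
Proof. by move=> QP h s a ns; apply: h => /QP. Qed.

(** Nakayama's lemma in the localization at [P], where the hypothesis reads: T is contained in X +
    PT. The generators of [T] are discarded one at a time, each being expressible through [X] and
    the remaining ones. *)
Lemma nakayama P X T : noetherian A -> prime_ideal P -> ideal X -> saturated P X ->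
  ideal T ->
  (forall t, T t -> exists2 s, ~ P s & exists p t', [/\ P p, T t' & X (s * t - p * t')]) ->
  forall t, T t -> X t.
Proof.
move=> nA pP hX sX hT h t Tt; have [s sP] := nA _ hT.
pose XG r := saturation P (ideal_add X (gen_ideal r)).
have XGid r : ideal (XG r).
  by apply: ideal_saturation => //; apply: ideal_addP => //; exact: ideal_gen.
suff {t Tt}TX : forall r, (forall a, a \in r -> T a) ->
    (forall t, T t -> XG r t) -> forall t, T t -> X t.
  apply: (TX s) Tt => [a /mem_gen_ideal /sP //|t' /sP st].
  by apply: sub_saturation => //; apply: ideal_addr.
elim=> [|a r IH] rT TX t Tt.
  have [q nq [b [c [Xb [[e ->] qt]]]]] := TX t Tt.
  by apply: (sX q) => //; rewrite qt big_ord0 addr0.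
have XGa v : XG (a :: r) v -> exists2 q, ~ P q & exists e, XG r (q * v - e * a).
  move=> [q nq [b [c [Xb [[e ->] qv]]]]]; exists q => //; exists (e ord0).
  rewrite qv big_ord_recl /=; set S := (X in _ + (_ + X) - _).
  have -> : b + (e ord0 * a + S) - e ord0 * a = b + S by ring.
  apply: sub_saturation => //.
  by exists b, S; split=> //; split=> //; exists (e \o lift ord0).
have XXG v : X v -> XG r v.
  by move=> Xv; apply: sub_saturation => //; apply: ideal_addl => //; exact: ideal_gen.
have aXG : XG r a.
  have [s1 ns1 [p [t' [Pp Tt' Xd]]]] := h a (rT a (mem_head _ _)).
  have [q nq [e he]] := XGa _ (TX _ Tt').
  (* Eliminating t' from s1 a = p t' and q t' = e a leaves this multiplier of a. It avoids [P], as q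
     s1 does and p e lies in [P]: it is a unit after localization. *)
  apply: (saturated_saturation pP (s := q * s1 - p * e)).
    have := prime_mul_notin pP nq ns1; apply: contra_not => h'.
    by rewrite -(subrK (p * e) (q * s1)); apply: pP.1.2.1 => //; apply: ideal_mulr => //; exact: pP.1.
  have -> : (q * s1 - p * e) * a = q * (s1 * a - p * t') + p * (q * t' - e * a) by ring.
  by apply: (XGid r).2.1; apply: (XGid r).2.2 => //; apply: XXG.
apply: IH Tt => [b br|v Tv]; first by apply: rT; rewrite inE br orbT.
have [q nq [e he]] := XGa _ (TX _ Tv).
apply: (saturated_saturation pP (s := q)) => //.
by rewrite -(subrK (e * a) (q * v)); apply: (XGid r).2.1 => //; apply: (XGid r).2.2.
Qed.

Definition colon I (a x : A) := I (x * a).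

Lemma ideal_colon I a : ideal I -> ideal (colon I a).
Proof.
move=> hI; rewrite /colon; split; first by rewrite mul0r; exact: hI.1.
split; first by move=> x y; rewrite mulrDl; apply: hI.2.1.
by move=> b x; rewrite -mulrA; apply: hI.2.2.
Qed.

(** An associated prime of A/I: take (I : a) maximal with a outside I. If bc lies in it and c does
    not, then (I : ca) contains both it and b, so b was in it already. *)
Lemma exists_prime_colon I : noetherian A -> ideal I -> ~ I 1 ->
  exists2 a, ~ I a & prime_ideal (colon I a).
Proof.
move=> nA hI nI1.
pose F J := exists2 a, ~ I a & J = colon I a.
have [] := @noetherian_maximal F (colon I 1) nA.
- by move=> _ [a _ ->]; apply: ideal_colon.
- by exists 1.
move=> _ [a nIa ->] amax; exists a => //; split; first exact: ideal_colon.
rewrite /colon in amax *; split; first by rewrite mul1r.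
move=> b c Ibc; case: (pselect (I (c * a))) => [|nIca]; [by right|left].
apply: (amax (colon I (c * a))); first by exists (c * a).
  by move=> x /(hI.2.2 c); rewrite /colon mulrCA.
by rewrite /colon mulrA.
Qed.

(* R_P / K is artinian when P is the only prime between K and P: adjoin to a
   maximal counterexample I an element a with (I : a) = P; the interval from
   I to sat(I + (a)) is then simple. *)
Lemma saturated_dcc P K : noetherian A -> prime_ideal P -> ideal K ->
  (forall Q, prime_ideal Q -> (forall x, K x -> Q x) -> (forall x, Q x -> P x) ->
     forall x, P x -> Q x) ->
  forall J : nat -> A -> Prop, (forall k, ideal (J k)) -> (forall k, saturated P (J k)) ->
  (forall k x, K x -> J k x) -> (forall k x, J k.+1 x -> J k x) ->
  exists k, forall l x, (k <= l)%N -> J k x -> J l x.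
Proof.
move=> nA pP hK Kmin.
pose dcc I := forall J : nat -> A -> Prop, (forall k, ideal (J k)) ->
  (forall k, saturated P (J k)) -> (forall k x, I x -> J k x) ->
  (forall k x, J k.+1 x -> J k x) -> exists k, forall l x, (k <= l)%N -> J k x -> J l x.
have dcc_sub I I' : (forall x, I x -> I' x) -> dcc I -> dcc I'.
  by move=> II' dI J Jid Js IJ Jd; apply: dI => // k x /II'; apply: IJ.
suff : dcc (saturation P K).
  move=> d J Jid Js KJ Jd; apply: d => // k x [s ns] /(KJ k); exact: Js.
apply: contrapT => nd.
pose F I := [/\ ideal I, saturated P I, forall x, K x -> I x & ~ dcc I].
have [] := @noetherian_maximal F (saturation P K) nA; first by move=> I [].
  split=> //; [exact: ideal_saturation|exact: saturated_saturation|move=> x; exact: sub_saturation].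
move=> I [hI sI KI ndI] Imax.
have nI1 : ~ I 1.
  move=> I1; apply: ndI => J Jid Js IJ Jd; exists 0%N => l x _ _.
  by rewrite -[x]mulr1; apply: (Jid l).2.2; apply: IJ.
have [a nIa pa] := exists_prime_colon nA hI nI1.
(* The prime (I : a) contains [K], and lies in [P] because [I] is saturated; by [Kmin] it contains
   [P]. *)
have Pa x : P x -> I (x * a).
  apply: (Kmin _ pa) => [y /KI|y Iya]; first by apply: ideal_mulr.
  by apply: contrapT => nPy; apply: nIa; apply: sI nPy Iya.
pose I' := saturation P (ideal_add I (principal a)).
have hIa : ideal (ideal_add I (principal a)) by apply: ideal_addP => //; exact: ideal_principal.
have hI' : ideal I' by exact: ideal_saturation.
have sI' : saturated P I' by exact: saturated_saturation.
have II' x : I x -> I' x.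
  by move=> Ix; apply: sub_saturation => //; apply: ideal_addl => //; exact: ideal_principal.
have dI' : dcc I'.
  apply: contrapT => ndI'; apply: nIa; apply: (Imax I') => //.
    by split=> // x /KI /II'.
  by apply: sub_saturation => //; apply: ideal_addr => //; exact: principal_id.
apply: ndI => J Jid Js IJ Jd.
have Jle i j x : (i <= j)%N -> J j x -> J i x.
  by move=> /subnK <-; elim: (j - i)%N => // d IH /Jd; exact: IH.
(* Simplicity of I'/I: up to a factor outside [P], b is r a modulo [I]. Since P a lies in [I], r is
   outside [P], so a is recovered from b. *)
have JI' k b : J k b -> I' b -> ~ I b -> J k a.
  move=> Jb [s ns [i [_ [Ii [[r ->] e]]]]] nIb.
  case: (pselect (P r)) => [Pr|nPr].
    by case: nIb; apply: sI ns _; rewrite e; apply: hI.2.1 => //; apply: Pa.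
  apply: (Js k r) => //; have -> : r * a = s * b - i by rewrite e addrC addKr.
  by apply: ideal_sub => //; [apply: (Jid k).2.2|apply: IJ].
have [k0 k0P] : exists k0, forall l, (k0 <= l)%N -> J k0 a -> J l a.
  case: (pselect (forall k, J k a)) => [h|/existsNP [k nJ]]; first by exists 0%N.
  by exists k => l _ /nJ.
(* The chain is stable once both its intersection with [I'], governed by whether a belongs to J k,
   and its sum with [I'] are stable. *)
pose J' k := saturation P (ideal_add (J k) I').
have [||||k1 k1P] := dI' J'.
- by move=> k; apply: ideal_saturation => //; apply: ideal_addP.
- by move=> k; apply: saturated_saturation.
- by move=> k x I'x; apply: sub_saturation => //; apply: ideal_addr.
- by move=> k x [s ns [b [c [Jb [Ic e]]]]]; exists s => //; exists b, c; split; [exact: Jd|].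
exists (maxn k0 k1) => l x; rewrite geq_max => /andP [l0 l1] Jx.
have [s ns [b [c [Jb [Ic e]]]]] : J' l x.
  apply: (k1P l) => //; apply: sub_saturation => //; apply: ideal_addl => //.
  by apply: Jle Jx; exact: leq_maxr.
apply: (Js l s) => //; rewrite e; apply: (Jid l).2.1 => //.
case: (pselect (I c)) => [/IJ //|nIc].
have /k0P Jla : J k0 a.
  apply: (JI' _ c) => //; have -> : c = s * x - b by rewrite e addrC addKr.
  apply: ideal_sub => //; last exact: Jle Jb.
  by apply: (Jid k0).2.2; apply: Jle Jx; exact: leq_maxl.
case: Ic => [t nt [i [_ [Ii [[r ->] e']]]]]; apply: (Js l t) => //; rewrite e'.
by apply: (Jid l).2.1; [apply: IJ|apply: (Jid l).2.2; apply: Jla].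
Qed.

Lemma prime_exp P x k : prime_ideal P -> P (x ^+ k) -> P x.
Proof.
move=> [_ [n1 h]]; elim: k => [|k IH]; first by rewrite expr0.
by rewrite exprS => /h [].
Qed.

(* Proof of the principal ideal theorem in which, in place of symbolic powers of Q,
   the ideals sat_Q(P0 + (y^k)) for one y in Q \ P0 suffice. *)
Lemma krull_exchange P0 Q P x : noetherian A ->
  prime_ideal P0 -> prime_ideal Q -> prime_ideal P ->
  (forall z, P0 z -> Q z) -> (exists z, Q z /\ ~ P0 z) ->
  (forall z, Q z -> P z) -> (exists z, P z /\ ~ Q z) -> P x ->
  exists Q', [/\ prime_ideal Q', forall z, P0 z -> Q' z, exists z, Q' z /\ ~ P0 z,
     forall z, Q' z -> P z & (exists z, P z /\ ~ Q' z) /\ Q' x].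
Proof.
move=> nA p0 pQ pP P0Q [y [Qy nP0y]] QP nPQ Px.
case: (pselect (Q x)) => [Qx|nQx]; first by exists Q; split=> //; exists y.
have nP0x : ~ P0 x by move/P0Q.
pose K := ideal_add P0 (principal x).
have hK : ideal K by apply: ideal_addP; [exact: p0.1|exact: ideal_principal].
apply: contrapT => nQ'.
(* Denying the conclusion makes [P] minimal over P0 + (x), as [saturated_dcc] requires. *)
have Kmin Q' : prime_ideal Q' -> (forall x, K x -> Q' x) -> (forall x, Q' x -> P x) ->
     forall x, P x -> Q' x.
  move=> pQ' KQ' Q'P z Pz; apply: contrapT => nQ'z; apply: nQ'; exists Q'.
  have Q'x : Q' x by apply: KQ'; apply: ideal_addr; [exact: p0.1|exact: principal_id].
  split=> //; last by split=> //; exists z.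
    by move=> t P0t; apply: KQ'; apply: ideal_addl => //; exact: ideal_principal.
  by exists x.
pose Qk k := saturation Q (ideal_add P0 (principal (y ^+ k))).
have hQk k : ideal (Qk k).
  by apply: ideal_saturation => //; apply: ideal_addP; [exact: p0.1|exact: ideal_principal].
have sQk k : saturated Q (Qk k) by exact: saturated_saturation.
have Qkd k z : Qk k.+1 z -> Qk k z.
  move=> [s ns [b [_ [P0b [[r ->] e]]]]]; exists s => //; exists b, (r * y ^+ k.+1).
  by split=> //; split=> //; exists (r * y); rewrite exprS mulrA.
have P0Qk k z : P0 z -> Qk k z.
  by move=> P0z; apply: sub_saturation => //; apply: ideal_addl => //; exact: ideal_principal.
have hJ k : ideal (ideal_add (Qk k) (principal x)).
  by apply: ideal_addP => //; exact: ideal_principal.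
have [||||k kP] := @saturated_dcc P K nA pP hK Kmin
    (fun k => saturation P (ideal_add (Qk k) (principal x))).
- by move=> k; apply: ideal_saturation.
- by move=> k; apply: saturated_saturation.
- move=> k z [b [c [P0b [Pc ->]]]]; apply: sub_saturation => //.
  by exists b, c; split=> //; apply: P0Qk.
- by move=> k z [s ns [b [c [Jb e]]]]; exists s => //; exists b, c; split=> //; apply: Qkd.
have QkS : forall z, Qk k z -> Qk k.+1 z.
  (* Stability modulo x gives s t = b + r x with b in [Qk k.+1]. As x is outside [Q], r lies in
     [Qk k], so Nakayama applies with the factor x of [P]. *)
  apply: (@nakayama P) => //; first exact: saturatedW (sQk _).
  move=> t Qt; have [] := kP k.+1 t (leqnSn k).
    by apply: sub_saturation => //; apply: ideal_addl => //; exact: ideal_principal.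
  move=> s ns [b [_ [Qb [[r ->] e]]]]; exists s => //; exists x, r; split=> //.
    apply: (sQk k x) => //; have -> : x * r = s * t - b by rewrite e mulrC addrC addKr.
    by apply: ideal_sub => //; [apply: (hQk k).2.2|apply: Qkd].
  by rewrite e [r * x]mulrC addrK.
have [|s ns [b [_ [P0b [[r ->] e]]]]] := QkS (y ^+ k).
  by apply: sub_saturation => //; apply: ideal_addr; [exact: p0.1|exact: principal_id].
apply: nP0y; apply: (@prime_exp _ _ k p0).
(* Since s is outside [Q] and y inside, s - r y is outside [Q], hence outside [P0]; so y^k must be
   in [P0]. *)
have : P0 ((s - r * y) * y ^+ k).
  by have -> : (s - r * y) * y ^+ k = b by rewrite mulrBl e exprS mulrA addrK.
case/p0.2.2 => // /P0Q Qsr; case: ns; rewrite -(subrK (r * y) s).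
by apply: pQ.1.2.1 => //; apply: pQ.1.2.2.
Qed.

(** The exchange on the top three primes pushes x one level down; the induction hypothesis treats
    the chain that ends in the new prime, and the old top is put back. *)
Lemma prime_chain_exchange d (P : nat -> A -> Prop) x : noetherian A ->
  prime_chain d.+1 P -> P d.+1 x ->
  exists P' : nat -> A -> Prop, [/\ prime_chain d P', P' d = P d.+1, P' 0%N x & forall z, P 0%N z -> P' 0%N z].
Proof.
move=> nA; elim: d P => [|d IH] P [pP sP] Px.
  exists (fun=> P 1%N); split=> //; last exact: (sP 0%N _).1.
  by split=> // i _; apply: pP.
have [Q [pQ PQ nPQ QP [nQP Qx]]] := krull_exchange nA (pP d (leqW (leqnSn _)))
  (pP d.+1 (leqnSn _)) (pP d.+2 (leqnn _))
  (sP d (leqnSn _)).1 (sP d (leqnSn _)).2 (sP d.+1 (leqnn _)).1 (sP d.+1 (leqnn _)).2 Px.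
pose P1 i := if (i <= d)%N then P i else Q.
have P1c : prime_chain d.+1 P1.
  split=> i id; rewrite /P1; first by case: leqP => // id'; apply: pP; lia.
  rewrite -ltnS id; case: ltnP => id'; first by apply: sP; lia.
  by have -> : i = d by lia.
have [|P' [P'c P'd P'x P'0]] := IH P1 P1c; first by rewrite /P1 ltnn.
rewrite /P1 ltnn in P'd.
exists (fun i => if (i <= d)%N then P' i else P d.+2); rewrite ltnn leq0n; split=> //.
split=> i id; first by case: leqP => id'; [apply: P'c.1|apply: pP].
rewrite -ltnS id; case: ltnP => id'; first exact: P'c.2.
have -> : i = d by lia.
by rewrite P'd.
Qed.

(** Krull's height theorem in chain form: each element of [s] costs one link, and the bottom prime
    only grows, so it keeps the elements already moved there. *)
Lemma prime_chain_containing d (P : nat -> A -> Prop) (s : seq A) : noetherian A ->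
  prime_chain (size s + d) P -> (forall x, x \in s -> P (size s + d)%N x) ->
  exists P' : nat -> A -> Prop, [/\ prime_chain d P', P' d = P (size s + d)%N,
    (forall x, x \in s -> P' 0%N x) & forall z, P 0%N z -> P' 0%N z].
Proof.
move=> nA; elim: s P => [|b s IH] P Pc sP; first by exists P.
have [|P1 [P1c P1d P1b P1P]] := prime_chain_exchange (x := b) nA Pc.
  by apply: sP; exact: mem_head.
have [|P' [P'c P'd P's P'0]] := IH P1 P1c.
  by move=> x xs; rewrite P1d; apply: sP; rewrite inE xs orbT.
exists P'; split=> //; first by rewrite P'd P1d.
  by move=> x; rewrite inE => /orP [/eqP ->|/P's //]; apply: P'0.
by move=> z /P1P /P'0.
Qed.

(** * Congruences modulo an ideal and products of ideals *)

Lemma ideal_prod_congr I T (r : seq T) (F G : T -> A) : ideal I ->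
  (forall i, I (F i - G i)) -> I (\prod_(i <- r) F i - \prod_(i <- r) G i).
Proof.
move=> hI FG; elim: r => [|i r IH]; first by rewrite !big_nil subrr; exact: hI.1.
rewrite !big_cons; set X := \prod_(_ <- _) F _ in IH *; set Y := \prod_(_ <- _) G _ in IH *.
have -> : F i * X - G i * Y = F i * (X - Y) + Y * (F i - G i) by ring.
by apply: hI.2.1; apply: hI.2.2.
Qed.

Lemma ideal_exp_congr I x y k : ideal I -> I (x - y) -> I (x ^+ k - y ^+ k).
Proof. by move=> hI Ixy; rewrite subrXX; apply: ideal_mulr. Qed.

Lemma ideal_congr_mul I x y x' y' : ideal I -> I (x - y) -> I (x' - y') ->
  I (x * x' - y * y').
Proof.
move=> hI Ixy Ixy'; have -> : x * x' - y * y' = x * (x' - y') + y' * (x - y) by ring.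
by apply: hI.2.1; apply: hI.2.2.
Qed.

Lemma ideal_congr_in I x y : ideal I -> I (x - y) -> I y -> I x.
Proof. by move=> hI Ixy Iy; rewrite -(subrK y x); apply: hI.2.1. Qed.

Lemma ideal_prod_ideal I J : ideal I -> ideal J -> ideal (@prod_ideal A I J).
Proof.
move=> hI hJ; split; first by exists 0%N, (fun=> 0), (fun=> 0); rewrite big_ord0; split=> // -[].
split.
  move=> _ _ [k [a [b [ab ->]]]] [k' [a' [b' [ab' ->]]]].
  exists (k + k')%N, (fun i => match fintype.split i with inl i => a i | inr i => a' i end),
    (fun i => match fintype.split i with inl i => b i | inr i => b' i end).
  split; first by move=> i; case: fintype.split => j.
  rewrite big_split_ord /=; congr (_ + _); apply: eq_bigr => i _.
    by rewrite (unsplitK (inl i)).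
  by rewrite (unsplitK (inr i)).
move=> r _ [k [a [b [ab ->]]]]; exists k, (fun i => r * a i), b; split.
  by move=> i; have [ai bi] := ab i; split=> //; apply: hI.2.2.
by rewrite big_distrr; apply: eq_bigr => i _; rewrite /= mulrA.
Qed.

End Ideals.

(** * Weighted monomial ideals *)

Section Weights.
Variable n1 : nat.
Notation expo := (n1.-tuple nat * nat)%type.
Implicit Types p q : expo.

Definition addx p q : expo := ([tuple (tnth p.1 j + tnth q.1 j)%N | j < n1], (p.2 + q.2)%N).

Definition yexp k : expo := ([tuple 0%N | j < n1], k).

Definition wt (wu : 'I_n1 -> nat) (wy : nat) p :=
  (\sum_(j < n1) wu j * tnth p.1 j + wy * p.2)%N.

Lemma wt_addx wu wy p q : wt wu wy (addx p q) = (wt wu wy p + wt wu wy q)%N.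
Proof.
rewrite /wt /= mulnDr addnACA -big_split; congr (_ + _)%N.
by apply: eq_bigr => j _; rewrite tnth_mktuple mulnDr.
Qed.

Lemma wt_yexp wu wy k : wt wu wy (yexp k) = (wy * k)%N.
Proof. by rewrite /wt big1 // => j _; rewrite tnth_mktuple muln0. Qed.

Lemma expo_eq p q : (forall j, tnth p.1 j = tnth q.1 j) -> p.2 = q.2 -> p = q.
Proof. by case: p q => [p1 p2] [q1 q2] /= h ->; congr (_, _); apply: eq_from_tnth. Qed.

Lemma addn_muln_inj E x y c d : (x < E)%N -> (y < E)%N ->
  (x + E * c = y + E * d -> x = y /\ c = d)%N.
Proof.
move=> xE yE e; suff cd : c = d by split=> //; move: e; rewrite cd => /addIn.
case: (ltngtP c d) => // h.
  by have : (E * c.+1 <= E * d)%N; [rewrite leq_mul2l h orbT|lia].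
by have : (E * d.+1 <= E * c)%N; [rewrite leq_mul2l h orbT|lia].
Qed.

Lemma digits_lt D n (a : 'I_n -> nat) : (forall j, (a j < D)%N) ->
  (\sum_(j < n) D ^ j * a j < D ^ n)%N.
Proof.
elim: n a => [|n IH] a aD; first by rewrite big_ord0.
rewrite big_ord_recr /= expnS; have := IH (fun j => a (widen_ord (leqnSn n) j)) (fun j => aD _).
have := aD ord_max; move: (\sum_(_ < _) _)%N (a _) (D ^ n)%N => X b E bD XE.
apply: (@leq_trans (E * b.+1)%N); first by rewrite mulnS ltn_add2r.
by rewrite mulnC leq_mul2r bD orbT.
Qed.

Lemma digits_inj D n (a b : 'I_n -> nat) : (forall j, (a j < D)%N) -> (forall j, (b j < D)%N) ->
  (\sum_(j < n) D ^ j * a j = \sum_(j < n) D ^ j * b j)%N -> a =1 b.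
Proof.
elim: n a b => [|n IH] a b aD bD; first by move=> _ [].
pose a' j := a (widen_ord (leqnSn n) j); pose b' j := b (widen_ord (leqnSn n) j).
rewrite !big_ord_recr /= => e.
have [e1 e2] := addn_muln_inj (@digits_lt D n a' (fun j => aD _)) (@digits_lt D n b' (fun j => bD _)) e.
move=> j; case: (unliftP ord_max j) => [i ->|->] //.
have := IH a' b' (fun j => aD _) (fun j => bD _) e1 i; rewrite /a' /b'.
by have -> : widen_ord (leqnSn n) i = lift ord_max i by apply: val_inj; rewrite /= /bump leqNgt ltn_ord.
Qed.

(* With [pwu, pwy], the base weights [b] of the [u_j] and [a] of [y1] are refined
   by the base-[D] number whose digits are the exponents, [y1] being the leading
   digit, so that distinct monomials with exponents [< D] get distinct weights. *)
Definition radix D := (D ^ n1.+1)%N.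
Definition pwu b D (j : 'I_n1) := (b * radix D + D ^ j)%N.
Definition pwy a D := (a * radix D + D ^ n1)%N.
Definition digits D p := wt (fun j => D ^ j)%N (D ^ n1)%N p.
Definition small D p := (forall j, (tnth p.1 j < D)%N) /\ (p.2 < D)%N.

Lemma wt_perturbed a b D p :
  wt (pwu b D) (pwy a D) p = (radix D * wt (fun=> b) a p + digits D p)%N.
Proof.
rewrite /digits /wt /pwu /pwy; under eq_bigr do rewrite mulnDl.
rewrite big_split /= mulnDl mulnDr big_distrr /= addnACA; congr (_ + _ + _)%N.
  by apply: eq_bigr => j _; rewrite mulnCA !mulnA.
by rewrite mulnCA !mulnA.
Qed.

Lemma digits_small D p : small D p -> (digits D p < D ^ n1 * p.2.+1)%N.
Proof.
move=> [h1 h2]; have := digits_lt h1; rewrite /digits /wt.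
by rewrite mulnS ltn_add2r.
Qed.

Lemma digits_radix D p : small D p -> (digits D p < radix D)%N.
Proof.
move=> sp; have := digits_small sp; case: sp => _ h; rewrite /radix expnS => /leq_trans; apply.
by rewrite mulnC leq_mul2r h orbT.
Qed.

Lemma digits_small_inj D p q : small D p -> small D q -> digits D p = digits D q -> p = q.
Proof.
move=> [p1 p2] [q1 q2] e; have [e1 e2] := addn_muln_inj (digits_lt p1) (digits_lt q1) e.
by apply: expo_eq => // j; apply: (digits_inj p1 q1 e1).
Qed.

(** The digit part of a small exponent is below [radix D], so it is the remainder of the weight
    modulo the radix and determines the exponent. *)
Lemma wt_perturbed_inj a b D p q : small D p -> small D q ->
  wt (pwu b D) (pwy a D) p = wt (pwu b D) (pwy a D) q -> p = q.
Proof.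
move=> sp sq; rewrite !wt_perturbed => e; apply: (digits_small_inj sp sq).
by move: e; rewrite addnC [RHS]addnC => /(addn_muln_inj (digits_radix sp) (digits_radix sq)) [].
Qed.

(** Every variable weighs at least [radix D], so an exponent [D] or larger would exceed the
    bound. *)
Lemma small_wt a b D p : (0 < a)%N -> (0 < b)%N ->
  (wt (pwu b D) (pwy a D) p < radix D * D)%N -> small D p.
Proof.
move=> a0 b0 h; have lt_D x y : (radix D <= x -> x * y < radix D * D -> y < D)%N.
  by move=> rx; apply: contraTT; rewrite -!leqNgt => Dy; apply: leq_mul.
split=> [j|].
  apply: (lt_D (pwu b D j)); first by rewrite /pwu (leq_trans _ (leq_addr _ _)) // leq_pmull.
  by apply: leq_ltn_trans h; rewrite /wt (bigD1 j) //= -addnA leq_addr.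
apply: (lt_D (pwy a D)); first by rewrite /pwy (leq_trans _ (leq_addr _ _)) // leq_pmull.
by apply: leq_ltn_trans h; rewrite /wt leq_addl.
Qed.

Lemma exists_small (S : seq expo) B : exists2 D, (B < D)%N & forall p, p \in S -> small D p.
Proof.
elim: S => [|p S [D BD DS]]; first by exists B.+1.
exists (D + (\sum_j tnth p.1 j + p.2).+1)%N; first lia.
move=> q; rewrite inE => /orP [/eqP ->|/DS [h1 h2]]; last first.
  by split=> [j|]; [have := h1 j|]; lia.
split=> [j|]; last lia.
by rewrite (bigD1 j) //=; lia.
Qed.

Lemma seq_argmin (X : eqType) d (T : orderType d) (S : seq X) (w : X -> T) x0 : x0 \in S ->
  exists2 x, x \in S & forall y, y \in S -> (w x <= w y)%O.
Proof.
elim: S x0 => // y S IH x0 _; case: S IH => [|y' S] IH.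
  by exists y; rewrite ?mem_head // => r; rewrite inE => /eqP ->.
have [x xS xP] := IH y' (mem_head _ _).
have [h|h] := leP (w x) (w y).
  exists x; first by rewrite inE xS orbT.
  by move=> r; rewrite inE => /orP [/eqP ->|/xP].
exists y; first exact: mem_head.
by move=> r; rewrite inE => /orP [/eqP ->//|/xP]; apply/le_trans/ltW.
Qed.

End Weights.

Section WeightedIdeals.
Variables (R : comUnitRingType) (M : R -> Prop) (n1 : nat) (u : 'I_n1 -> R) (y1 : R).
Notation expo := (n1.-tuple nat * nat)%type.
Notation mon := (mon u y1).
Implicit Types p q : expo.

Lemma mon_addx p q : mon (addx p q) = mon p * mon q.
Proof.
rewrite /Defs.mon /= exprD mulrACA -big_split; congr (_ * _).
by apply: eq_bigr => j _; rewrite tnth_mktuple exprD.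
Qed.

Lemma mon_yexp k : mon (yexp n1 k) = y1 ^+ k.
Proof. by rewrite /Defs.mon big1 ?mul1r // => j _; rewrite tnth_mktuple. Qed.

(** The ideal generated by the monomials of weight at least t, encoded as an intersection of ideals:
    a property of its members is proved by choosing [J]. *)
Definition wideal wu wy (t : nat) (a : R) :=
  forall J, ideal J -> (forall p, (t <= wt wu wy p)%N -> J (mon p)) -> J a.

Section FixedWeights.
Variables (wu : 'I_n1 -> nat) (wy : nat).
Notation wt := (wt wu wy).
Notation wideal := (wideal wu wy).

Lemma ideal_wideal t : ideal (wideal t).
Proof.
split; first by move=> J hJ _; exact: hJ.1.
split; first by move=> a b ha hb J hJ h; apply: hJ.2.1; [apply: ha|apply: hb].
by move=> r a ha J hJ h; apply: hJ.2.2; apply: ha.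
Qed.

Lemma wideal_mon t p : (t <= wt p)%N -> wideal t (mon p).
Proof. by move=> h J hJ; apply. Qed.

Lemma widealW s t a : (t <= s)%N -> wideal s a -> wideal t a.
Proof.
move=> ts; apply => [|p sp]; first exact: ideal_wideal.
by apply: wideal_mon; apply: leq_trans sp.
Qed.

Lemma wideal0 a : wideal 0 a.
Proof.
rewrite -[a]mulr1; apply: (ideal_wideal 0).2.2.
by rewrite -[1](expr0 y1) -mon_yexp; apply: wideal_mon.
Qed.

Lemma wideal_mul s t a b : wideal s a -> wideal t b -> wideal (s + t) (a * b).
Proof.
move=> ha hb; have hI := ideal_wideal (s + t).
apply: (ha (fun a => wideal (s + t) (a * b))) => [|p sp].
  by rewrite -/(colon _ _); exact: ideal_colon.
apply: (hb (fun b => wideal (s + t) (mon p * b))) => [|q tq]; last first.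
  by rewrite -mon_addx; apply: wideal_mon; rewrite wt_addx leq_add.
under eq_fun do rewrite mulrC; exact: ideal_colon.
Qed.

Lemma wideal_exp t a k : wideal t a -> wideal (t * k) (a ^+ k).
Proof.
move=> ta; elim: k => [|k IH]; first by rewrite muln0; exact: wideal0.
by rewrite mulnS exprS; apply: wideal_mul.
Qed.

End FixedWeights.

Hypotheses (nR : noetherian R) (lR : local_ring M).
Hypothesis chainR : exists P, @prime_chain R n1.+1 P.
Hypothesis genM : forall x, M x <-> gen_ideal (y1 :: [seq u i | i <- enum 'I_n1]) x.

Lemma M_y1 : M y1. Proof. by apply/genM/mem_gen_ideal/mem_head. Qed.

Lemma M_u j : M (u j).
Proof. by apply/genM/mem_gen_ideal; rewrite inE map_f ?orbT ?mem_enum. Qed.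

Lemma M_sub I : ideal I -> I y1 -> (forall j, I (u j)) -> forall x, M x -> I x.
Proof.
move=> hI Iy Iu x /genM; apply: gen_ideal_sub => // a; rewrite inE => /orP [/eqP -> //|].
by move=> /mapP [j _ ->].
Qed.

Lemma M_n1 : ~ M 1. Proof. by move/lR.2; rewrite unitr1. Qed.

Lemma prime_M : prime_ideal M.
Proof.
split; first exact: lR.1; split; first exact: M_n1.
by move=> a b /lR.2; rewrite unitrM negb_and => /orP [] /lR.2; [left|right].
Qed.

(** The top of a chain of n1 + 1 links may be replaced by [M]; moving n1 elements to the bottom
    leaves one link, a prime strictly inside [M]. *)
Lemma exists_prime_containing (s : seq R) : size s = n1 -> (forall x, x \in s -> M x) ->
  exists Q, [/\ prime_ideal Q, forall x, x \in s -> Q x, forall x, Q x -> M x &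
    exists2 x, M x & ~ Q x].
Proof.
move=> sz sM; have [P [pP sP]] := chainR.
have PM x : P n1.+1 x -> M x.
  move=> Px; apply/lR.2/negP => /unitrP [z [zx _]].
  by have [hP [n1P _]] := pP _ (leqnn n1.+1); apply: n1P; rewrite -zx; apply: hP.2.2.
pose P1 i := if (i <= n1)%N then P i else M.
have P1c : prime_chain (size s + 1) P1.
  rewrite sz addn1; split=> i id; rewrite /P1.
    by case: leqP => id'; [exact: pP|exact: prime_M].
  rewrite -ltnS id; case: ltnP => id'; first by apply: sP.
  have {id id'} -> : i = n1 by lia.
  have [h [z [Pz nPz]]] := sP n1 (leqnn _).
  by split=> [x /h /PM //|]; exists z; split=> //; apply: PM.
have [|P' [[pP' sP'] P'd P's _]] := prime_chain_containing nR P1c.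
  by move=> x /sM; rewrite sz addn1 /P1 ltnn.
rewrite sz addn1 /P1 ltnn in P'd.
have [P'M [x [Mx nP'x]]] := sP' 0%N isT; rewrite P'd in P'M Mx.
by exists (P' 0%N); split=> //; [exact: pP'|exists x].
Qed.

(* A prime Q <> M containing the n1 elements u_j^wy - y1^(wu j) behaves like the
   curve u_j = t^(wu j), y1 = t^wy, on which a monomial of weight w has order w. *)
Lemma mon_notin_wideal wu wy p : (forall j, (0 < wu j)%N) -> (0 < wy)%N ->
  ~ wideal wu wy (wt wu wy p).+1 (mon p).
Proof.
move=> wu0 wy0 hp.
have wyE : wy.-1.+1 = wy by rewrite prednK.
pose s := [seq u j ^+ wy - y1 ^+ wu j | j <- enum 'I_n1].
have [||Q [pQ sQ QM [x Mx nQx]]] := @exists_prime_containing s.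
- by rewrite size_map size_enum_ord.
- move=> _ /mapP [j _ ->]; rewrite -wyE -(prednK (wu0 j)).
  by apply: ideal_sub; rewrite ?exprS; [exact: lR.1|apply: (ideal_mulr _ lR.1); exact: M_u|apply: (ideal_mulr _ lR.1); exact: M_y1].
have gQ j : Q (u j ^+ wy - y1 ^+ wu j) by apply: sQ; apply: map_f; rewrite mem_enum.
have [hQ [nQ1 Qpr]] := pQ.
suff Qy : Q y1.
  apply: nQx; apply: (M_sub hQ) Mx => // j; apply: (prime_exp (k := wy)) => //.
  apply: ideal_congr_in (gQ j) _ => //; rewrite -(prednK (wu0 j)) exprS.
  exact: ideal_mulr.
(* Modulo [Q], each full power u_j^wy becomes y1^(wu j), so a monomial r is a multiple of y1^(E r).
   The leftover exponents, below wy, cost at most [C]. *)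
pose C := (\sum_j wu j)%N.
pose E r := (\sum_(j < n1) wu j * (tnth r.1 j %/ wy) + r.2)%N.
have EC r : (wt wu wy r <= wy * (E r + C))%N.
  rewrite /wt /E /C addnAC mulnDr leq_add2r -big_split big_distrr /=.
  apply: leq_sum => j _; rewrite -mulnSr mulnCA leq_mul2l; apply/orP; right.
  by rewrite {1}(divn_eq (tnth r.1 j) wy) mulnC mulnS addnC leq_add2r ltnW ?ltn_mod.
have monE r : exists d, Q (mon r - d * y1 ^+ E r).
  exists (\prod_j u j ^+ (tnth r.1 j %% wy)).
  rewrite /E exprD mulrA expr_sum -big_split /=.
  apply: ideal_congr_mul => //; last by rewrite subrr; exact: hQ.1.
  apply: ideal_prod_congr => // j.
  rewrite {1}(divn_eq (tnth r.1 j) wy) exprD mulrC mulnC !exprM.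
  apply: ideal_congr_mul => //; first by rewrite subrr; exact: hQ.1.
  exact: ideal_exp_congr.
have wQ (q : nat) a : wideal wu wy (wy * (q + C)) a -> ideal_add Q (principal (y1 ^+ q)) a.
  apply; first by apply: ideal_addP => //; exact: ideal_principal.
  move=> r hr; have [d Qd] := monE r; exists (mon r - d * y1 ^+ E r), (d * y1 ^+ E r).
  split=> //; split; last by rewrite subrK.
  exists (d * y1 ^+ (E r - q)); rewrite -mulrA -exprD subnK //.
  by have := leq_trans hr (EC r); rewrite leq_mul2l => /orP []; lia.
set t := wt wu wy p in hp.
have pQE l : Q (mon p ^+ (wy * l) - y1 ^+ (t * l)).
  rewrite /t /wt mulnDl exprD /Defs.mon exprMn.
  apply: ideal_congr_mul => //; last first.
    by rewrite -exprM mulnCA mulnA subrr; exact: hQ.1.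
  rewrite big_distrl /= expr_sum -prodrXl.
  apply: ideal_prod_congr => // j.
  rewrite -exprM mulnCA -!mulnA (exprM _ wy) (exprM _ (wu j)).
  exact: ideal_exp_congr.
(* The assumed gain of one unit of weight is amplified by the power wy (C + 1): it absorbs the loss
   [C] and still leaves one extra factor y1. *)
have [|b [_ [Qb [[r ->] e]]]] := wQ (t * C.+1).+1 (mon p ^+ (wy * C.+1)).
  by apply: (widealW _ (wideal_exp (k := wy * C.+1) hp)); rewrite mulnCA leq_mul2l; apply/orP; right; rewrite mulSn addnC addSnnS.
(* The second factor is a unit, so the prime [Q] would contain y1. *)
have : Q (y1 ^+ (t * C.+1) * (1 - r * y1)).
  have -> : y1 ^+ (t * C.+1) * (1 - r * y1) = b - (mon p ^+ (wy * C.+1) - y1 ^+ (t * C.+1)).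
    by rewrite e exprS; ring.
  exact: ideal_sub.
case/Qpr => [h|/QM M1]; first exact: (prime_exp pQ h).
case: M_n1.
rewrite -(subrK (r * y1) 1); apply: lR.1.2.1 => //; apply: lR.1.2.2; exact: M_y1.
Qed.

Lemma M_wideal wu wy E a : (forall j, (E <= wu j)%N) -> (E <= wy)%N ->
  M a -> wideal wu wy E a.
Proof.
move=> hu hy; apply: M_sub; first exact: ideal_wideal.
  by rewrite -[y1]expr1 -mon_yexp; apply: wideal_mon; rewrite wt_yexp muln1.
move=> j; pose p : expo := ([tuple (i == j : nat) | i < n1], 0%N).
have -> : u j = mon p.
  rewrite /Defs.mon mulr1 (bigD1 j) //= tnth_mktuple eqxx big1 ?mulr1 // => i /negPf h.
  by rewrite tnth_mktuple h.
apply: wideal_mon; rewrite /wt (bigD1 j) //= tnth_mktuple eqxx muln1 -addnA.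
exact: leq_trans (leq_addr _ _).
Qed.

Lemma ipow_wideal wu wy E s a : (forall j, (E <= wu j)%N) -> (E <= wy)%N ->
  ipow M s a -> wideal wu wy (E * s) a.
Proof.
move=> hu hy; elim: s a => [|s IH] a /=; first by rewrite muln0 => _; exact: wideal0.
move=> [k [b [c [bc ->]]]]; apply: ideal_sum => [|i _]; first exact: ideal_wideal.
have [Mb sc] := bc i; rewrite mulnS; apply: wideal_mul; last exact: IH.
exact: M_wideal.
Qed.

(** The weight bound t is raised step by step. At most one monomial has weight t, so h is c times it
    modulo larger weight; a non-unit c lies in [M] and adds weight, so the process stops only at a
    unit. *)
Lemma wideal_leading wu wy T h : (forall j, (0 < wu j)%N) -> (0 < wy)%N ->
  (forall p q, wt wu wy p = wt wu wy q -> (wt wu wy p <= T)%N -> p = q) ->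
  wideal wu wy T.+1 h \/ exists c p, [/\ (wt wu wy p <= T)%N, c \is a GRing.unit &
    wideal wu wy (wt wu wy p).+1 (h - c * mon p)].
Proof.
move=> wu0 wy0 sep.
suff : forall t, (t <= T.+1)%N -> wideal wu wy t h \/ exists c p,
    [/\ (wt wu wy p <= T)%N, c \is a GRing.unit & wideal wu wy (wt wu wy p).+1 (h - c * mon p)].
  exact.
elim=> [|t IH] tT; first by left; exact: wideal0.
have [|ht|] := IH; [exact: ltnW| |by right].
have hI := ideal_wideal wu wy t.+1.
case: (pselect (exists p, wt wu wy p = t)) => [[p pt]|npt]; last first.
  left; apply: ht => // p; rewrite leq_eqVlt => /orP [/eqP e|]; last exact: wideal_mon.
  by case: npt; exists p.
have [c hc] : exists c, wideal wu wy t.+1 (h - c * mon p).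
  apply: (ht (fun h => exists c, wideal wu wy t.+1 (h - c * mon p))) => [|q].
    split; first by exists 0; rewrite mul0r subrr; exact: hI.1.
    split; first by move=> x y [c hc] [d hd]; exists (c + d); rewrite mulrDl opprD addrACA; apply: hI.2.1.
    by move=> r x [c hc]; exists (r * c); rewrite -mulrA -mulrBr; apply: hI.2.2.
  rewrite leq_eqVlt => /orP [/eqP e|tq]; last first.
    by exists 0; rewrite mul0r subr0; apply: wideal_mon.
  have -> : q = p by apply: sep; rewrite -e ?pt.
  by exists 1; rewrite mul1r subrr; exact: hI.1.
case: (boolP (c \is a GRing.unit)) => cu.
  by right; exists c, p; rewrite pt.
left; rewrite -(subrK (c * mon p) h); apply: hI.2.1 => //.
rewrite -add1n; apply: wideal_mul; last by apply: wideal_mon; rewrite pt.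
by apply: M_wideal => //; apply/lR.2.
Qed.

End WeightedIdeals.

(** * Expansions in the parameters *)

Section Expansions.
Variables (R : comUnitRingType) (M : R -> Prop) (n1 : nat) (u : 'I_n1 -> R) (y1 : R).
Notation expo := (n1.-tuple nat * nat)%type.
Notation mon := (mon u y1).
Implicit Types p q : expo.

Hypotheses (nR : noetherian R) (lR : local_ring M).
Hypothesis chainR : exists P, @prime_chain R n1.+1 P.
Hypothesis genM : forall x, M x <-> gen_ideal (y1 :: [seq u i | i <- enum 'I_n1]) x.

Variables (S : seq expo) (c : expo -> R) (f : R).
Hypotheses (uS : uniq S) (cS : forall p, p \in S -> c p \is a GRing.unit).
Hypothesis fE : f = \sum_(p <- S) c p * mon p.

Lemma expansion_leading wu wy p : p \in S ->
  (forall q, q \in S -> (wt wu wy p <= wt wu wy q)%N) ->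
  (forall q, q \in S -> wt wu wy p = wt wu wy q -> p = q) ->
  wideal u y1 wu wy (wt wu wy p).+1 (f - c p * mon p).
Proof.
move=> pS pmin pinj; have hI := ideal_wideal u y1 wu wy (wt wu wy p).+1.
rewrite fE (bigD1_seq p) //= addrAC subrr add0r big_seq_cond.
apply: ideal_sum => // q /andP [qS qp]; apply: hI.2.2; apply: wideal_mon.
rewrite ltn_neqAle pmin // andbT; apply/eqP => /(pinj q qS) e.
by rewrite e eqxx in qp.
Qed.

Lemma wideal_unit_mul wu wy t a x : a \is a GRing.unit ->
  wideal u y1 wu wy t (a * x) -> wideal u y1 wu wy t x.
Proof. by move=> ua h; rewrite -[x](mulKr ua); apply: (ideal_wideal _ _ _ _ _).2.2. Qed.

(** Perturbed weights over the base weight 1 single out one leading monomial, of minimal degree.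
    Were its degree below m, membership of f in M^m would put it among larger weights. *)
Lemma expansion_degree m : ipow M m f ->
  forall p, p \in S -> (m <= wt (fun=> 1%N) 1 p)%N.
Proof.
move=> fm p pS; rewrite leqNgt; apply/negP => pm.
have [D D0 DS] := exists_small S 0.
set wu := @pwu n1 1 D; set wy := pwy n1 1 D.
have wpos : (forall j, (radix n1 D <= wu j)%N) /\ (radix n1 D <= wy)%N.
  by rewrite /wu /wy /pwu /pwy !mul1n; split=> [j|]; rewrite leq_addr.
have r0 : (0 < radix n1 D)%N by rewrite expn_gt0 D0.
have [p' p'S p'min] := seq_argmin (wt wu wy) pS.
have lead : wideal u y1 wu wy (wt wu wy p').+1 (f - c p' * mon p').
  apply: expansion_leading => // q qS.
  by apply: wt_perturbed_inj; apply: DS.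
apply: (@mon_notin_wideal _ M _ u y1 nR lR chainR genM wu wy p').
- by move=> j; exact: (leq_trans r0 (wpos.1 j)).
- exact: (leq_trans r0 wpos.2).
apply: (wideal_unit_mul (cS p'S)); rewrite -[c p' * _](subKr f).
apply: (ideal_sub (ideal_wideal _ _ _ _ _)) => //.
apply: widealW (ipow_wideal genM wpos.1 wpos.2 fm).
apply: leq_ltn_trans (p'min p pS) _; rewrite wt_perturbed.
apply: (@leq_trans (radix n1 D * (wt (fun=> 1%N) 1 p).+1)%N).
  by rewrite mulnS addnC ltn_add2r; apply/digits_radix/DS.
by rewrite leq_mul2l pm orbT.
Qed.

(** With weight 2 on the u_j and 1 on y1, y1^m is the only monomial of degree at least m whose
    weight is at most m. If it were missing from [S], then f, and with it y1^m, would have weight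
    above m. *)
Lemma expansion_yexp m : ipow M m f -> ipow M m.+1 (f - y1 ^+ m) -> yexp n1 m \in S.
Proof.
move=> fm fym; apply: contraPT isT => yS _.
apply: (@mon_notin_wideal _ M _ u y1 nR lR chainR genM (fun=> 2%N) 1 (yexp n1 m)) => //.
have hI := ideal_wideal u y1 (fun=> 2%N) 1 (wt (fun=> 2%N) 1 (yexp n1 m)).+1.
rewrite mon_yexp -(subKr f (y1 ^+ m)); apply: (ideal_sub hI) => //.
  rewrite fE big_seq; apply: ideal_sum => // p pS; apply: hI.2.2; apply: wideal_mon.
  rewrite wt_yexp mul1n; have := expansion_degree fm pS.
  rewrite /wt -!big_distrr /= !mul1n; set s := (\sum_j _)%N => mp.
  case: (posnP s) => s0; last lia.
  rewrite s0 muln0 add0n ltn_neqAle; rewrite s0 add0n in mp; rewrite mp andbT.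
  apply: contraNN yS => /eqP e; suff <- : p = yexp n1 m by [].
  apply: expo_eq => // j; rewrite tnth_mktuple.
  by apply/eqP; rewrite -leqn0 -s0 /s (bigD1 j) //= leq_addr.
have := @ipow_wideal _ M _ u y1 genM (fun=> 2%N) 1 1 m.+1 _ (fun=> isT) isT fym.
by rewrite wt_yexp !mul1n.
Qed.

(* The leading monomial of f for the perturbed weights involves some u_j, hence so
   does that of h * f, which therefore cannot cancel y1^k. *)
Lemma y1_exp_bound a b m p0 : (0 < b <= a)%N ->
  (forall p, p \in S -> (a * m <= wt (fun=> b) a p)%N) ->
  p0 \in S -> wt (fun=> b) a p0 = (a * m)%N -> (p0.2 < m)%N ->
  forall k s h, ipow M s (y1 ^+ k - h * f) -> (b * s <= a * k)%N.
Proof.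
move=> /andP [b0 ab] Sm p0S p0w p0m k s h hs; rewrite leqNgt; apply/negP => sk.
have a0 : (0 < a)%N by apply: leq_trans ab.
(* This bound keeps the weight [T] of y1^k below [radix D * D], so all monomials of weight at most
   [T] are small and have distinct weights. *)
have [D DB DS] := exists_small S (k * a.+1).
have D0 : (0 < D)%N by apply: leq_ltn_trans DB.
have kD : (k < D)%N by apply: leq_ltn_trans DB; rewrite mulnS leq_addr.
have d0 : (0 < D ^ n1)%N by rewrite expn_gt0 D0.
set wu := @pwu n1 b D; set wy := pwy n1 a D.
have rE : radix n1 D = (D * D ^ n1)%N by rewrite /radix expnS.
have r0 : (0 < radix n1 D)%N by rewrite expn_gt0 D0.
have wul : forall j, (b * radix n1 D <= wu j)%N by move=> j; rewrite leq_addr.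
have wyl : (b * radix n1 D <= wy)%N.
  by apply: leq_trans (leq_addr _ _); rewrite leq_mul2r ab orbT.
have wu0 j : (0 < wu j)%N by apply: leq_trans (wul j); rewrite muln_gt0 b0.
have wy0 : (0 < wy)%N by apply: leq_trans wyl; rewrite muln_gt0 b0.
have key := @mon_notin_wideal _ M _ u y1 nR lR chainR genM wu wy _ wu0 wy0.
have [p pS pmin] := seq_argmin (wt wu wy) p0S.
have lead : wideal u y1 wu wy (wt wu wy p).+1 (f - c p * mon p).
  apply: expansion_leading => // q qS.
  by apply: wt_perturbed_inj; apply: DS.
(* A pure power of y1 in [S] has exponent at least m, more than that of [p0]. Its base weight is no
   smaller than that of [p0] and its leading digit is larger, so it cannot be minimal. *)
have [j pj] : exists j, tnth p.1 j != 0%N.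
  apply: contrapT => /forallNP pj.
  have p1 j : tnth p.1 j = 0%N by apply/eqP; have /negP := pj j; rewrite negbK.
  have pm : (m <= p.2)%N.
    have := Sm p pS; rewrite /wt big1 ?add0n ?leq_pmul2l // => j _.
    by rewrite p1 muln0.
  have : (wt wu wy p <= wt wu wy p0)%N := pmin p0 p0S.
  rewrite !wt_perturbed leqNgt => /negP; apply.
  rewrite p0w -addnS leq_add //; first by rewrite leq_mul2l Sm ?orbT.
  apply: leq_trans (digits_small (DS _ p0S)) _.
  apply: (@leq_trans (D ^ n1 * p.2)%N); first by rewrite leq_mul2l (leq_trans p0m) ?orbT.
  by rewrite /digits /wt leq_addl.
pose T := wt wu wy (yexp n1 k).
have TE : T = (wy * k)%N by rewrite /T wt_yexp.
have TD : (T < radix n1 D * D)%N.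
  rewrite TE /wy /pwy; apply: (@leq_ltn_trans (radix n1 D * (k * a.+1))%N).
    rewrite mulnC [X in (_ <= X)%N]mulnCA leq_mul2l; apply/orP; right.
    by rewrite mulnS addnC mulnC leq_add2r rE leq_pmull.
  by rewrite ltn_mul2l r0.
(* The strict inequality a k < b s leaves a full radix of room, and the digit part D^n1 k of [T]
   fits in it because k < D. *)
have Ts : (T < b * radix n1 D * s)%N.
  rewrite mulnAC TE; apply: (@leq_trans ((a * k).+1 * radix n1 D)%N); last by rewrite leq_mul2r sk orbT.
  by rewrite /wy /pwy mulnDl mulSn addnC mulnAC ltn_add2r rE mulnC ltn_mul2r d0.
have {hs}hT : wideal u y1 wu wy T.+1 (y1 ^+ k - h * f).
  exact: widealW (ipow_wideal genM wul wyl hs).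
have sep (q q' : expo) : wt wu wy q = wt wu wy q' -> (wt wu wy q <= T)%N -> q = q'.
  move=> e qT; have q'T : (wt wu wy q' <= T)%N by rewrite -e.
  apply: wt_perturbed_inj e; apply: (@small_wt _ a b) => //; exact: leq_ltn_trans TD.
have hI t := ideal_wideal u y1 wu wy t.
have yT : ~ wideal u y1 wu wy T.+1 (y1 ^+ k) by rewrite -(mon_yexp u); apply: key.
have [hT'|[d [q [qT du hq]]]] := wideal_leading lR genM h wu0 wy0 sep.
  by apply: yT; rewrite -(subrK (h * f) (y1 ^+ k)); apply: (hI _).2.1 => //; apply: (ideal_mulr _ (hI _)).
set v := wt wu wy (addx q p).
have vE : v = (wt wu wy q + wt wu wy p)%N by rewrite /v wt_addx.
have hf : wideal u y1 wu wy v.+1 (h * f - d * c p * mon (addx q p)).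
  rewrite mon_addx.
  have -> : h * f - d * c p * (mon q * mon p) =
     (h - d * mon q) * f + d * (mon q * (f - c p * mon p)) by ring.
  apply: (hI _).2.1.
    rewrite vE -addSn; apply: wideal_mul => //.
    rewrite fE big_seq; apply: ideal_sum => // r rS; apply: (hI _).2.2; apply: wideal_mon.
    exact: pmin.
  by apply: (hI _).2.2; rewrite vE -addnS; apply: wideal_mul => //; apply: wideal_mon.
(* In y1^k - h f, the leading term of smaller weight would survive uncancelled. At equal weights,
   separation identifies the two monomials, but one of them contains u_j. *)
case: (ltngtP v T) => vT.
- apply: (key (addx q p)); apply: (wideal_unit_mul (a := d * c p)); first by rewrite unitrM du cS.
  have -> : d * c p * mon (addx q p) = y1 ^+ k - (y1 ^+ k - h * f) - (h * f - d * c p * mon (addx q p)) by ring.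
  apply: (ideal_sub (hI _)) => //; apply: (ideal_sub (hI _)) => //; last by apply: widealW hT; apply: leq_trans vT _.
  by rewrite -(mon_yexp u); apply: wideal_mon.
- apply: yT.
  have -> : y1 ^+ k = y1 ^+ k - h * f + ((h * f - d * c p * mon (addx q p)) + d * c p * mon (addx q p)) by ring.
  apply: (hI _).2.1 => //; apply: (hI _).2.1; first by apply: widealW hf; lia.
  by apply: (hI _).2.2; apply: wideal_mon.
have := sep _ _ vT; rewrite -/v vT leqnn => /(_ isT) /(congr1 (fun r : expo => tnth r.1 j)).
by rewrite !tnth_mktuple => /eqP; rewrite addn_eq0 (negPf pj) andbF.
Qed.

End Expansions.

(** * Powers of an ideal and the asymptotic order *)

Section Powers.
Variables (A : comUnitRingType) (I : A -> Prop).
Hypothesis hI : ideal I.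

Lemma ideal_ipow s : ideal (ipow I s).
Proof. by elim: s => [|s IH] //; exact: ideal_prod_ideal. Qed.

Lemma ipowS_mul a b s : I a -> ipow I s b -> ipow I s.+1 (a * b).
Proof. by move=> Ia sb; exists 1%N, (fun=> a), (fun=> b); rewrite big_ord1. Qed.

Lemma ipowW s t a : (s <= t)%N -> ipow I t a -> ipow I s a.
Proof.
move=> /subnK <-; elim: (t - s)%N => // d IH [k [b [c [bc e]]]]; apply: IH.
rewrite e; apply: ideal_sum => [|i _]; first exact: ideal_ipow.
by apply: (ideal_ipow _).2.2; have [] := bc i.
Qed.

Lemma ipow_exp_mul a k s b : I a -> ipow I s b -> ipow I (k + s) (a ^+ k * b).
Proof.
move=> Ia sb; elim: k => [|k IH]; first by rewrite mul1r.
by rewrite exprS -mulrA; apply: ipowS_mul.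
Qed.

Lemma ipow_prod_exp (T : Type) (r : seq T) (a : T -> A) (e : T -> nat) :
  (forall i, I (a i)) -> ipow I (\sum_(i <- r) e i) (\prod_(i <- r) a i ^+ e i).
Proof.
by move=> Ia; elim: r => [|i r IH]; rewrite ?big_nil // !big_cons; apply: ipow_exp_mul.
Qed.

Variable K : realType.
Local Open Scope ereal_scope.
Local Open Scope classical_set_scope.

(** A squeeze between q - C/k and q; [harmonic k] is 1/(k+1), in step with the shifted index of
    [nubar]. *)
Lemma nubar_eq (x : A) (q C : K) :
  (forall k s, ipow I s (x ^+ k)%R -> (s%:R <= q * k%:R)%R) ->
  (forall k, exists2 s, ipow I s (x ^+ k)%R & (q * k%:R - C <= s%:R)%R) ->
  nubar K I x = q%:E.
Proof.
move=> ub lb; apply: cvg_lim; first exact: ereal_hausdorff.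
pose l (k : nat) : K := (q - C * harmonic k)%R.
apply: (@squeeze_cvge _ _ _ _ (EFin \o l) _ (fun=> q%:E)).
- near=> k; have kp : (0 < (k.+1%:R : K)^-1)%R by rewrite invr_gt0.
  have kn : (k.+1%:R : K) != 0%R by rewrite pnatr_eq0.
  apply/andP; split.
    have [s sx sl] := lb k.+1.
    apply: (@le_trans _ _ ((s%:R)%:E * ((k.+1)%:R^-1)%:E)).
      rewrite -EFinM lee_fin /l /harmonic -(mulfK kn q) -mulrBl.
      by rewrite ler_pM2r.
    apply: lee_wpmul2r; first by rewrite lee_fin ltW.
    by apply: ereal_sup_ubound; exists s.
  apply: (@le_trans _ _ ((q * k.+1%:R)%:E * ((k.+1)%:R^-1)%:E)).
    apply: lee_wpmul2r; first by rewrite lee_fin ltW.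
    by apply: ge_ereal_sup => _ [s sx <-]; rewrite lee_fin; apply: ub.
  by rewrite -EFinM mulfK.
- apply: cvg_EFin; first by near=> k.
  have : (fun k => q - C * harmonic k)%R @ \oo --> (q - C * 0)%R.
    exact: (cvgB (cvg_cst q) (cvgM (cvg_cst C) (@cvg_harmonic K))).
  by rewrite mulr0 subr0.
- exact: cvg_cst.
Unshelve. all: by end_near.
Qed.

Lemma nubar_nilpotent (x : A) m : (x ^+ m = 0)%R -> nubar K I x = +oo.
Proof.
move=> xm; apply: cvg_lim; first exact: ereal_hausdorff.
apply: cvg_near_cst; near=> k.
have km : (m <= k)%N by near: k; exists m.
rewrite -{1}(subnK (leqW km)) exprD xm mulr0.
have -> : nu K I 0%R = +oo.
  apply: eq_infty => r; have := archi_boundP (normr_ge0 r) => /ltW rs.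
  apply: (@le_trans _ _ (((Num.bound `|r|)%:R)%:E)); first by rewrite lee_fin (le_trans (ler_norm _)).
  by apply: ereal_sup_ubound; exists (Num.bound `|r|) => //; exact: (ideal_ipow _).1.
by rewrite gt0_mulye // lte_fin invr_gt0.
Unshelve. all: by end_near.
Qed.

End Powers.

(** * The quotient by f *)

Section Quotient.
Variables (R R' : comUnitRingType) (M : R -> Prop) (M' : R' -> Prop).
Variables (pi : {rmorphism R -> R'}) (f : R).
Hypotheses (lR : local_ring M) (lR' : local_ring M') (Mf : M f).
Hypothesis pi_surj : forall x' : R', exists x, pi x = x'.
Hypothesis pi_ker : forall x, pi x = 0 <-> exists a, x = a * f.

Lemma quotient_M x : M' (pi x) <-> M x.
Proof.
split=> [/lR'.2 h|Mx].
  by apply/lR.2; apply: contraNN h; exact: rmorph_unit.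
apply/lR'.2/negP => /unitrP [z' [zx _]].
have [z zE] := pi_surj z'; move: zx; rewrite -zE -rmorphM -(rmorph1 pi) => /eqP.
rewrite -subr_eq0 -rmorphB => /eqP/pi_ker [a e].
have : M 1.
  rewrite -(subKr (z * x) 1) e; apply: (ideal_sub lR.1); first exact: lR.1.2.2.
  exact: lR.1.2.2.
by move/lR.2; rewrite unitr1.
Qed.

Lemma ipow_quotient s x' : ipow M' s x' -> exists2 x, ipow M s x & pi x = x'.
Proof.
elim: s x' => [|s IH] x'; first by move=> _; have [x <-] := pi_surj x'; exists x.
move=> [k [a [b [ab ->]]]].
have /choice [g gP] : forall i, exists z : R * R, [/\ M z.1, ipow M s z.2, pi z.1 = a i & pi z.2 = b i].
  move=> i; have [ai bi] := ab i; have [z2 z2M z2E] := IH _ bi.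
  have [z1 z1E] := pi_surj (a i); exists (z1, z2); split=> //.
  by apply/quotient_M; rewrite z1E.
exists (\sum_(i < k) (g i).1 * (g i).2).
  by exists k, (fun i => (g i).1), (fun i => (g i).2); split=> // i; have [] := gP i.
rewrite rmorph_sum; apply: eq_bigr => i _.
by have [_ _ <- <-] := gP i; rewrite rmorphM.
Qed.

Lemma ipow_quotient_lift s x : ipow M' s (pi x) -> exists h, ipow M s (x - h * f).
Proof.
move=> /ipow_quotient [z zM zE].
have /pi_ker [h e] : pi (x - z) = 0 by rewrite rmorphB zE subrr.
by exists h; rewrite -e subKr.
Qed.

Variables (n1 : nat) (u : 'I_n1 -> R) (y1 : R).
Notation expo := (n1.-tuple nat * nat)%type.
Notation mon := (mon u y1).
Implicit Types p q : expo.
Hypothesis Mu : forall j, M (u j).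

Lemma ipow_mon p : ipow M' (\sum_j tnth p.1 j) (pi (mon p)).
Proof.
rewrite rmorphM mulrC; apply: (ideal_ipow lR'.1 _).2.2.
rewrite rmorph_prod (eq_bigr (fun j => pi (u j) ^+ tnth p.1 j)) => [|j _]; last exact: rmorphXn.
by apply: (@ipow_prod_exp _ _ _ _ (fun j => pi (u j)) (tnth p.1)) => j; apply/quotient_M.
Qed.

Variables (S : seq expo) (c : expo -> R) (m a b : nat).
Hypotheses (uS : uniq S) (cS : forall p, p \in S -> c p \is a GRing.unit).
Hypothesis fE : f = \sum_(p <- S) c p * mon p.
Hypotheses (yS : yexp n1 m \in S) (Sm : forall p, p \in S -> p != yexp n1 m -> (p.2 < m)%N).

(** The unit coefficient of y1^m in f = 0 is inverted. A general [J] serves both for the zero ideal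
    and for colon ideals. *)
Lemma pi_y1_exp (J : R' -> Prop) : ideal J ->
  (forall p, p \in S -> (p.2 < m)%N -> J (pi (mon p))) -> J (pi (y1 ^+ m)).
Proof.
move=> hJ SJ.
have cV := cS yS.
have f0 : pi f = 0 by apply/pi_ker; exists 1; rewrite mul1r.
rewrite -(mulKr cV (y1 ^+ m)) rmorphM; apply: hJ.2.2.
rewrite -(mon_yexp u); move: f0; rewrite fE (bigD1_seq (yexp n1 m)) //= rmorphD.
move=> /eqP; rewrite addr_eq0 => /eqP ->; apply: ideal_opp => //.
rewrite rmorph_sum big_seq_cond; apply: ideal_sum => // p /andP [pS py].
by rewrite rmorphM; apply: hJ.2.2; apply: SJ => //; apply: Sm.
Qed.

Hypotheses (m0 : (0 < m)%N) (Sw : forall p, p \in S -> (a * m <= wt (fun=> b) a p)%N).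

(** Induction on k, applied to the colon ideal (J : y1). When the exponent of y1 reaches m, y1^m is
    rewritten by f = 0, which does not lower the weight by [Sw]. *)
Lemma pi_y1_exp_in k (J : R' -> Prop) : ideal J ->
  (forall p, (p.2 < m)%N -> (a * k <= wt (fun=> b) a p)%N -> J (pi (mon p))) ->
  J (pi (y1 ^+ k)).
Proof.
elim: k J => [|k IH] J hJ SJ.
  by rewrite -(mon_yexp u); apply: SJ => //; rewrite muln0.
rewrite exprSr rmorphM.
apply: (IH (fun z => J (z * pi y1))) => [|p pm pk]; first exact: (ideal_colon (pi y1) hJ).
rewrite -rmorphM.
have := pm; rewrite leq_eqVlt => /orP [/eqP e|lt_pm]; last first.
  have -> : mon p * y1 = mon (addx p (yexp n1 1)) by rewrite mon_addx mon_yexp.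
  apply: SJ; first by rewrite /= addn1.
  by rewrite wt_addx wt_yexp muln1 mulnS addnC leq_add2r.
pose p' : expo := (p.1, 0%N).
have -> : mon p * y1 = y1 ^+ m * mon p' by rewrite /Defs.mon /= mulr1 -mulrA -exprSr e mulrC.
rewrite rmorphM.
apply: (pi_y1_exp (J := fun z => J (z * pi (mon p')))) => [|q qS qm]; first exact: (ideal_colon (pi (mon p')) hJ).
rewrite -rmorphM -mon_addx; apply: SJ; first by rewrite /= addn0.
rewrite wt_addx mulnS; apply: (@leq_trans (a * m + wt (fun=> b) a p')%N); last first.
  by rewrite leq_add2r Sw.
move: pk; rewrite /wt /p' /= muln0 addn0 -e; lia.
Qed.

(** A monomial u^alpha y1^i with i < m and weight at least a k has b |alpha| >= a (k - i) >= a (k -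
    m). *)
Lemma pi_y1_exp_ipow k : (0 < b)%N -> ipow M' ((a * (k - m)) %/ b) (pi y1 ^+ k).
Proof.
move=> b0; rewrite -rmorphXn; apply: pi_y1_exp_in; first exact: (ideal_ipow lR'.1).
move=> p pm pk; apply: (ipowW lR'.1) (ipow_mon p).
rewrite -[X in (_ <= X)%N](mulKn _ b0); apply: leq_div2r.
apply: (@leq_trans (a * k - a * p.2)%N); first by rewrite -mulnBr leq_mul2l leq_sub2l ?orbT // ltnW.
by rewrite leq_subLR addnC; move: pk; rewrite /wt -big_distrr.
Qed.

End Quotient.

(** * Hironaka's polyhedron *)

Section Polyhedron.
Variables (K : realType) (n1 m : nat) (S : seq (n1.-tuple nat * nat)).
Notation expo := (n1.-tuple nat * nat)%type.
Implicit Types p q : expo.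

Definition slope p : K := (\sum_j tnth p.1 j)%:R / (m - p.2)%:R.

Lemma delta_hironaka_empty : (forall p, p \in S -> (m <= p.2)%N) ->
  delta (@hironaka n1 K m S) = +oo%E.
Proof.
move=> Sm; have -> : @hironaka n1 K m S = set0; last by rewrite /delta image_set0 ereal_inf0.
apply/seteqP; split=> // g [[|k] [lam [p [w [_ [s1 [pS _]]]]]]].
  by move: s1; rewrite big_ord0 => /eqP; rewrite eq_sym oner_eq0.
by have [/Sm] := pS ord0; rewrite leqNgt => /negP.
Qed.

(** The coordinate sum is linear and grows under translation by N^{n-1}, so its minimum is attained
    at a generating point. *)
Lemma delta_hironaka p0 : p0 \in S -> (p0.2 < m)%N ->
  (forall p, p \in S -> (p.2 < m)%N -> slope p0 <= slope p) ->
  delta (@hironaka n1 K m S) = (slope p0)%:E.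
Proof.
move=> p0S p0m min; apply/eqP; rewrite eq_le; apply/andP; split.
  apply: ereal_inf_lbound; exists (fun j => (tnth p0.1 j)%:R / (m - p0.2)%:R).
    exists 1%N, (fun=> 1), (fun=> p0), (fun=> [tuple 0%N | j < n1]).
    split=> //; split; first by rewrite big_ord1.
    by split=> // j; rewrite big_ord1 mul1r tnth_mktuple addr0.
  by rewrite /slope -mulr_suml natr_sum.
apply: le_ereal_inf_tmp => _ [g [k [lam [p [w [lam0 [lam1 [pS gE]]]]]]] <-].
rewrite lee_fin; under eq_bigr do rewrite gE.
have -> : slope p0 = \sum_(i < k) lam i * slope p0 by rewrite -mulr_suml lam1 mul1r.
rewrite exchange_big /=.
apply: ler_sum => i _; rewrite -mulr_sumr; apply: ler_wpM2l => //.
have [piS pim] := pS i; apply: le_trans (min _ piS pim) _.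
rewrite big_split /= -mulr_suml /slope natr_sum lerDl.
by apply: sumr_ge0 => j _; exact: ler0n.
Qed.

End Polyhedron.

(** * Comparison of the asymptotic order with the polyhedron *)

Theorem theorem8p2 (K : realType) (R : comUnitRingType) (M : R -> Prop)
    (n1 : nat) (f : R) (m : nat)
    (R' : comUnitRingType) (M' : R' -> Prop) (pi : {rmorphism R -> R'})
    (u : 'I_n1 -> R) (y1 : R)
    (S : seq (n1.-tuple nat * nat)) (c : n1.-tuple nat * nat -> R) :
  regular_local M n1.+1 ->
  ~~ (f \is a GRing.unit) ->
  nu K M f = (m%:R)%:E -> (1 < m)%N ->
  (forall x' : R', exists x, pi x = x') ->
  (forall x, pi x = 0 <-> exists a, x = a * f) ->
  local_ring M' ->
  extremal K M' ->
  (forall x, M x <-> gen_ideal (y1 :: [seq u i | i <- enum 'I_n1]) x) ->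
  same_initial_form M m f (y1 ^+ m) ->
  CP_expansion u y1 f S c ->
  nubar K M' (pi y1) = delta (@hironaka n1 K m S).
Proof.
move=> [nR [lR [[chainR _] _]]] nuf _ m1 surj ker lR' _ genM [fm [_ [_ [_ fym]]]] [uS [cS [fE Smin]]].
have Mf : M f by apply/lR.2.
have Mu := M_u genM; have m0 : (0 < m)%N by apply: ltnW.
have deg := expansion_degree nR lR chainR genM uS cS fE fm.
have yS := expansion_yexp nR lR chainR genM uS cS fE fm fym.
(* Any other monomial with y1-exponent at least m is a multiple of y1^m, against the minimality of
   [S]. *)
have Sm p : p \in S -> p != yexp n1 m -> (p.2 < m)%N.
  move=> pS py; rewrite ltnNge; apply/negP => mp; apply: (Smin p pS).
  have -> : mon u y1 p = mon u y1 (p.1, (p.2 - m)%N) * y1 ^+ m.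
    by rewrite /mon /= -mulrA -exprD subnK.
  apply: (ideal_gen _).2.2; apply: mem_gen_ideal; rewrite -(mon_yexp u).
  by apply: map_f; rewrite mem_filter eq_sym py.
have [/hasP [p1 p1S p1m]|/hasPn noS] := boolP (has (fun p => p.2 < m)%N S); last first.
  rewrite delta_hironaka_empty => [|p /noS]; last by rewrite -leqNgt.
  apply: (@nubar_nilpotent _ _ lR'.1 _ _ m); rewrite -rmorphXn.
  apply: (pi_y1_exp (J := fun z => z = 0) ker uS cS fE yS Sm) => [|p /noS /negP //].
  by split=> //; split=> [x y -> ->|x y ->]; rewrite ?addr0 ?mulr0.
have [|p0] := seq_argmin (@slope K n1 m) (S := [seq p <- S | (p.2 < m)%N]) (x0 := p1).
  by rewrite mem_filter p1m.
rewrite mem_filter => /andP [p0m p0S] p0min.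
have {}p0min p : p \in S -> (p.2 < m)%N -> slope K m p0 <= slope K m p.
  by move=> pS pm; apply: p0min; rewrite mem_filter pm.
rewrite (delta_hironaka p0S p0m p0min).
pose a := (\sum_j tnth p0.1 j)%N; pose b := (m - p0.2)%N.
have b0 : (0 < b)%N by rewrite subn_gt0.
have bK : (b%:R : K) != 0 by rewrite pnatr_eq0 -lt0n.
have wtE p : wt (fun=> b) a p = (b * \sum_j tnth p.1 j + a * p.2)%N by rewrite /wt -big_distrr.
(* The degree a + i of [p0] is at least m = b + i; hence y1, of weight a, weighs at least b, as do
   the u_j. *)
have ab : (0 < b <= a)%N.
  rewrite b0 /=; have := deg p0 p0S; rewrite /wt -big_distrr /= !mul1n -/a addnC => h.
  by rewrite leq_subLR.
(* For i < m this is the minimality of the slope a/b with denominators cleared. *)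
have Sw p : p \in S -> (a * m <= wt (fun=> b) a p)%N.
  move=> pS; rewrite wtE; have [pm|pm] := ltnP p.2 m; last first.
    by apply: leq_trans (leq_addl _ _); rewrite leq_mul2l pm orbT.
  have := p0min p pS pm; rewrite /slope -/a -/b.
  rewrite ler_pdivrMr ?ltr0n // mulrAC ler_pdivlMr ?ltr0n ?subn_gt0 //.
  rewrite -!natrM ler_nat => h.
  rewrite -[X in (a * X)%N](subnK (ltnW pm)) mulnDr leq_add2r.
  by rewrite [X in (_ <= X)%N]mulnC.
have p0w : wt (fun=> b) a p0 = (a * m)%N.
  by rewrite wtE -/a mulnC -mulnDr subnK // ltnW.
have sE : slope K m p0 = a%:R / b%:R by [].
(* The constant collects the loss a m / b from k - m in place of k, and 1 for rounding the quotient
   down. *)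
apply: (nubar_eq (C := a%:R * m%:R / b%:R + 1)); rewrite sE.
  move=> k s; rewrite -rmorphXn => /(ipow_quotient_lift lR lR' Mf surj ker) [h hs].
  have := y1_exp_bound nR lR chainR genM uS cS fE ab Sw p0S p0w p0m hs.
  by rewrite mulrAC ler_pdivlMr ?ltr0n // -!natrM ler_nat mulnC.
move=> k; exists ((a * (k - m)) %/ b)%N.
  exact: (pi_y1_exp_ipow lR lR' Mf surj ker Mu uS cS fE yS Sm m0 Sw k b0).
rewrite mulrAC lerBlDr ler_pdivrMr ?ltr0n // !mulrDl divfK // mul1r -!natrM -!natrD ler_nat.
have := ltn_ceil (a * (k - m)) b0; set d := ((a * (k - m)) %/ b)%N => hd.
apply: (@leq_trans (a * (k - m) + a * m)%N).
  by rewrite -mulnDr leq_mul2l addnC -leq_subLR leqnn orbT.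
by move: hd; rewrite mulSn; move: (a * (k - m))%N (d * b)%N (a * m)%N => X Y Z; lia.
Qed.
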